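(* Let $J\in\{[0,\infty),\mathbb{R}\}$, let $X$ be a real Banach space and let $E=X\oplus iX$ be its complexification. Let $\mathfrak{g}(t)=e^{it^2}$ for $t\in\mathbb{R}$. (i) If $\phi:J\to\mathbb{R}$ is a function with $(T\phi)(s,\cdot)\in UC(J,\mathbb{C})$ for each $s>0$, then $\phi\in BUC(J,\mathbb{R})$. (ii) If $\phi:J\to X$ is a function with $(T\phi)(s,\cdot)\in UC(J,E)$ for each $s>0$, then $\phi\in BUC(J,X)$. (iii) If $f:J\to X$ is a function and $\phi=f/\mathfrak{g}$ satisfies $(T\phi)(s,\cdot)\in UC(J,E)$ for each $s>0$, then $f\in\Delta C_0(J,X)$.
   Context: $E=X\oplus iX$ is the complex linear space with multiplication $(a+ib)(y_1+iy_2)=(ay_1-by_2)+i(by_1+ay_2)$, endowed with the (product) topology of the norm $\|y_1+iy_2\|=\max\{\|y_1\|,\|y_2\|\}$ (or any of the equivalent norms $(\|y_1\|^p+\|y_2\|^p)^{1/p}$, $1\le p<\infty$); $X$ is identified with $X\oplus\{0\}\subset E$. For a function $f$ on $J$ and $s>0$, $(\Delta_s f)(t)=f(t+s)-f(t)$. For $\phi:J\to E$ (or $\phi: J\to\mathbb{C}$) and $s,t\in J$, $$(T\phi)(s,t)=e^{i(s^2+2st)}\phi(s+t)-\phi(t)=\frac{1}{\mathfrak{g}(t)}\Delta_s(\mathfrak{g}\phi)(t).$$ For a Banach space $Y$: $UC(J,Y)$, $BUC(J,Y)$, $C_0(J,Y)$ denote the spaces of uniformly continuous (not necessarily bounded),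 bounded uniformly continuous, and continuous vanishing at infinity functions $J\to Y$; and $\Delta C_0(J,Y)=\{\phi\in L^1_{loc}(J,Y): \Delta_h\phi\in C_0(J,Y)\text{ for all }h>0\}$. *)

(* Defs.v *)
From HB Require Import structures.
From mathcomp Require Import all_boot all_order all_algebra.
From mathcomp Require Import all_classical all_reals all_analysis.
From mathcomp Require Export complex.

Set Implicit Arguments.
Unset Strict Implicit.
Unset Printing Implicit Defensive.

Import Order.TTheory GRing.Theory Num.Theory.
Import numFieldNormedType.Exports.

Local Open Scope classical_set_scope.
Local Open Scope ring_scope.
Local Open Scope complex_scope.

(* The pair (y1, y2) stands for y1 + i y2.  The norm of X * X is the maximum
   of the norms of the components; it is not homogeneous for the complex
   scaling below, so the complexification is a normed Z-module and a complex
   vector space, but not a normed module over R[i]. *)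
Definition complexification (R : realType) (X : normedModType R) : Type :=
  (X * X)%type.

Section complexification_theory.
Context {R : realType} {X : normedModType R}.

HB.instance Definition _ :=
  PseudoMetricNormedZmod.copy (complexification X) (X * X)%type.

Definition cplx_scale (c : R[i]) (y : complexification X) :
    complexification X :=
  let: a +i* b := c in (a *: y.1 - b *: y.2, b *: y.1 + a *: y.2).

Fact cplx_scaleA a b v :
  cplx_scale a (cplx_scale b v) = cplx_scale (a * b) v.
Proof.
case: a b v => a a' [b b'] [x y]; congr pair => /=;
  rewrite !scalerBr !scalerDr !scalerBl !scalerDl !scalerA.
  by rewrite !opprD addrACA.
by rewrite addrACA; congr (_ + _); rewrite addrC.
Qed.

Fact cplx_scale1 : left_id 1 cplx_scale.
Proof.
by case=> x y; congr pair; rewrite /= scale1r scale0r ?subr0 ?add0r.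
Qed.

Fact cplx_scaleDr : right_distributive cplx_scale +%R.
Proof.
case=> a b [x y] [x' y']; congr pair => /=; rewrite !scalerDr.
  by rewrite opprD addrACA.
by rewrite addrACA.
Qed.

Fact cplx_scaleDl v : {morph cplx_scale^~ v : a b / a + b}.
Proof.
case: v => x y [a b] [a' b']; congr pair => /=; rewrite !scalerDl.
  by rewrite opprD addrACA.
by rewrite addrACA.
Qed.

HB.instance Definition _ := GRing.Zmodule_isLmodule.Build R[i]
  (complexification X) cplx_scaleA cplx_scale1 cplx_scaleDr cplx_scaleDl.

Definition to_complexification (x : X) : complexification X := (x, 0).

End complexification_theory.

(* A function on J is represented by a total function on R, of which only the
   values at points of J matter. *)

Definition UC {R : realType} {Y : uniformType} (J : set R) (f : R -> Y) : Prop :=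
  unif_continuous (f : subspace J -> Y).

Definition BUC {R : realType} {Y : normedModType R} (J : set R) (f : R -> Y) :
    Prop :=
  UC J f /\ [bounded f t | t in J].

Definition C0 {R : realType} {Y : normedModType R} (J : set R) (f : R -> Y) :
    Prop :=
  {within J, continuous f} /\
  forall e : R, 0 < e ->
    exists M : R, forall t, J t -> M < `|t| -> `|f t| < e.

Definition simple_function {R : realType} {Y : normedModType R} (s : R -> Y) :
    Prop :=
  finite_set (range s) /\ forall y, measurable (s @^-1` [set y]).

(* Bochner's strong measurability. *)
Definition strongly_measurable {R : realType} {Y : normedModType R}
    (J : set R) (f : R -> Y) : Prop :=
  exists s : nat -> R -> Y, (forall n, simple_function (s n)) /\
    {ae lebesgue_measure, forall t, J t -> s n t @[n --> \oo] --> f t}.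

(* Local integrability is integrability on the compact subsets of J; for
   J = [0, +oo[ these may contain 0. *)
Definition L1loc {R : realType} {Y : normedModType R} (J : set R) (f : R -> Y) :
    Prop :=
  strongly_measurable J f /\
  forall K, K `<=` J -> compact K ->
    (\int[lebesgue_measure]_(t in K) `|f t|%:E < +oo)%E.

Definition Delta {R : realType} {Y : zmodType} (s : R) (f : R -> Y) : R -> Y :=
  fun t => f (t + s) - f t.

Definition DeltaC0 {R : realType} {Y : normedModType R} (J : set R)
    (f : R -> Y) : Prop :=
  L1loc J f /\ forall h : R, 0 < h -> C0 J (Delta h f).

Definition expi {R : realType} (x : R) : R[i] := cos x +i* sin x.

Definition gauss {R : realType} (t : R) : R[i] := expi (t ^+ 2).

Definition Tdiff {R : realType} {E : lmodType R[i]} (phi : R -> E) (s t : R) :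
    E :=
  expi (s ^+ 2 + 2 * s * t) *: phi (s + t) - phi t.

Lemma expiD {R : realType} (x y : R) : expi (x + y) = expi x * expi y.
Proof.
rewrite /expi cosD sinD; apply/eqP; rewrite eq_complex /=.
by rewrite eqxx addrC eqxx.
Qed.

Lemma expi_neq0 {R : realType} (x : R) : expi x != 0.
Proof.
apply/eqP => x0; have := expiD x (- x).
rewrite x0 mul0r subrr /expi cos0 => /eqP; rewrite eq_complex /=.
by rewrite oner_eq0.
Qed.

Lemma TdiffE {R : realType} {E : lmodType R[i]} (phi : R -> E) (s t : R) :
  Tdiff phi s t = (gauss t)^-1 *: Delta s (fun u => gauss u *: phi u) t.
Proof.
rewrite /Tdiff /Delta scalerBr !scalerA mulVf ?expi_neq0// scale1r [t + s]addrC.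
congr (_ *: _ - _); rewrite /gauss.
have -> : (s + t) ^+ 2 = (s ^+ 2 + 2 * s * t) + t ^+ 2.
  by rewrite sqrrD -mulrA mulr_natl.
by rewrite [in RHS]expiD mulrCA mulVf ?mulr1// expi_neq0.
Qed.

(* Main.v *)
Require Import Defs.
From mathcomp Require Import all_boot all_order all_algebra.
From mathcomp Require Import all_classical all_reals all_analysis.
From mathcomp Require Import lra ring.
Import Order.TTheory GRing.Theory Num.Theory.
Import numFieldNormedType.Exports.
Local Open Scope classical_set_scope.
Local Open Scope ring_scope.
Local Open Scope complex_scope.

(* (i), (ii): the imaginary part of [T phi] says that
   [sin (s^2 + 2 s t) phi (s + t)] is uniformly continuous in [t]; its zeros are
   relatively dense, so it is bounded.  Combining [s = 1] and [s = 2], whose sines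
   have no common zero, [phi (2 + t)] is bounded and uniformly continuous, and the
   real part of [T phi] for [s = 2] carries this over to [phi].

   (iii): the hypothesis says that [cos (t^2) d] and [sin (t^2) d] are uniformly
   continuous, where [d] is the [s]-difference of [f].  Their zeros accumulate at
   infinity, so both vanish there, and so does [d].  Hence all differences of [f]
   are in [C_0]; then [f] is a pointwise limit of continuous functions, has small
   oscillation somewhere by Baire's theorem, and therefore everywhere since its
   differences are continuous.  So [f] is continuous, hence locally integrable. *)

(** * Lipschitz bounds and zeros of sine and cosine *)

Lemma dist_sin_le {R : realType} (x y : R) : `|sin x - sin y| <= `|x - y|.
Proof.
wlog xy : x y / y <= x => [H|].
  by have [/H//|/ltW/H] := leP y x; rewrite distrC (distrC y).
have [|c _ ->] := @MVT_segment R sin cos y x xy (fun z _ => is_derive_sin z).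
  exact/continuous_subspaceT/continuous_sin.
by rewrite normrM ler_piMl// cos_max.
Qed.

Lemma dist_cos_le {R : realType} (x y : R) : `|cos x - cos y| <= `|x - y|.
Proof.
rewrite -!sinDpihalf (le_trans (dist_sin_le _ _))//.
by rewrite opprD addrACA subrr addr0.
Qed.

(** Since [sin (x + pi) = - sin x], the intermediate value theorem applies between [x] and
    [x + pi]. *)
Lemma sin_zero_near {R : realType} (x : R) :
  exists2 y : R, x <= y <= x + pi & sin y = 0.
Proof.
have xp : x <= x + pi by rewrite lerDl pi_ge0.
have [||y] := @IVT R sin x (x + pi) 0 xp.
- exact/continuous_subspaceT/continuous_sin.
- rewrite sinDpi; case: (leP 0 (sin x)) => s0.
    by rewrite ge_min le_max oppr_le0 s0 orbT.
  by rewrite ge_min le_max oppr_ge0 (ltW s0) orbT.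
by rewrite in_itv/= => yx y0; exists y.
Qed.

Lemma cos_zero_near {R : realType} (x : R) :
  exists2 y : R, x <= y <= x + pi & cos y = 0.
Proof.
have [y yx y0] := sin_zero_near (x + pi / 2).
exists (y - pi / 2); last by rewrite cosBpihalf.
by apply/andP; split; lra.
Qed.

(** * Uniform continuity on [J] *)

(** In the uniformity of [subspace J], two points are close when they coincide or when both lie in
    [J] and are close in [R]; the coinciding pairs cost nothing. *)
Lemma UCP {R : realType} {Y : pseudoMetricNormedZmodType R} (J : set R)
    (f : R -> Y) :
  UC J f <-> forall e : R, 0 < e -> exists2 d : R, 0 < d &
    forall x y, J x -> J y -> `|x - y| < d -> `|f x - f y| < e.
Proof.
split => [fJ e e0|H].
  have /fJ : entourage [set xy : Y * Y | ball xy.1 e xy.2].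
    by rewrite -entourage_from_ballE; exists e.
  case=> /= E; rewrite -entourage_from_ballE => -[d /= d0 dE] EJ.
  exists d => // x y Jx Jy xyd.
  have : E (x, y) by apply: dE; rewrite /= -ball_normE.
  move=> Exy; have := EJ (x, y) (or_intror (conj Jx (conj Jy Exy))).
  by rewrite /= -ball_normE.
move=> A; rewrite -entourage_from_ballE => -[e /= e0 eA].
have [d d0 dH] := H _ e0.
exists [set xy : R * R | ball xy.1 d xy.2] => /=.
  by rewrite -entourage_from_ballE; exists d.
move=> [x y] /= xy; apply: (eA (f x, f y)); rewrite /= -ball_normE/=.
case: xy => [<-|[Jx [Jy]]]; first by rewrite subrr normr0.
by rewrite -ball_normE/=; exact: dH.
Qed.

Lemma UC_comp {R : realType} {Y Z : uniformType} (J : set R) (f : R -> Y)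
    (g : Y -> Z) : unif_continuous g -> UC J f -> UC J (g \o f).
Proof. by move=> gu fu A /gu /fu. Qed.

Lemma UC_fst {R : realType} {X : normedModType R} (J : set R)
    (f : R -> complexification X) : UC J f -> UC J (fun t => (f t).1 : X).
Proof.
move=> /UCP fJ; apply/UCP => e /fJ[d d0 H]; exists d => // x y Jx Jy /H.
by rewrite prod_normE gt_max => /(_ Jx Jy) /andP[].
Qed.

Lemma UC_snd {R : realType} {X : normedModType R} (J : set R)
    (f : R -> complexification X) : UC J f -> UC J (fun t => (f t).2 : X).
Proof.
move=> /UCP fJ; apply/UCP => e /fJ[d d0 H]; exists d => // x y Jx Jy /H.
by rewrite prod_normE gt_max => /(_ Jx Jy) /andP[].
Qed.

(** Allows the scalar case to be deduced from the vector case. The norm of [R[i]^o] is itself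
    complex-valued, hence the radii [e%:C]. *)
Lemma complex_to_complexification_unif_continuous {R : realType} :
  unif_continuous (fun z : R[i]^o =>
    (complex.Re z, complex.Im z) : complexification R^o).
Proof.
move=> A; rewrite -entourage_from_ballE => -[e /= e0 eA].
apply: (filterS (P := [set xy : R[i]^o * R[i]^o | ball xy.1 e%:C xy.2])) => /=.
  move=> [x y] /=; rewrite -ball_normE/= => xye; apply: eA.
  case: x y xye => [a b] [a' b'] xye.
  rewrite /= -ball_normE/= prod_normE gt_max/= -!ltcR; apply/andP; split.
    exact: le_lt_trans (normc_ge_Re ((a - a') +i* (b - b'))) xye.
  (* Swapping the two components preserves the modulus, so the bound on real parts also bounds
     imaginary parts. *)
  apply: le_lt_trans (normc_ge_Re ((b - b') +i* (a - a'))) _.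
  by rewrite normc_def/= addrC -(normc_def ((a - a') +i* (b - b'))).
rewrite -entourage_from_ballE; exists e%:C => //=.
by rewrite ltcR.
Qed.

Lemma UCB {R : realType} {Y : pseudoMetricNormedZmodType R} (J : set R)
    (f g : R -> Y) : UC J f -> UC J g -> UC J (fun t => f t - g t).
Proof.
move=> /UCP fJ /UCP gJ; apply/UCP => e e0.
have e2 : 0 < e / 2 by rewrite divr_gt0.
have [[d d0 dH] [d' d'0 dH']] := (fJ _ e2, gJ _ e2).
exists (Num.min d d'); first by rewrite lt_min d0.
move=> x y Jx Jy; rewrite lt_min => /andP[xyd xyd'].
rewrite opprD addrACA -opprD (le_lt_trans (ler_normB _ _))// [e]splitr ltrD//.
  exact: dH.
exact: dH'.
Qed.

Lemma UCN {R : realType} {Y : pseudoMetricNormedZmodType R} (J : set R)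
    (f : R -> Y) : UC J f -> UC J (fun t => - f t).
Proof.
move=> /UCP fu; apply/UCP => e /fu[d d0 H]; exists d => // x y Jx Jy /H.
by rewrite -opprD normrN; apply.
Qed.

(** * Boundedness from uniform continuity; products and sums in [UC] and [BUC] *)

(** Walk up from the smaller point in steps of length [d / 2], each changing [f] by at most 1; the
    number of steps depends only on [L]. Upward closure keeps the walk in [J]. *)
Lemma UC_dist_bounded {R : realType} {X : normedModType R} (J : set R)
    (f : R -> X) (L : R) :
  (forall x y, J x -> x <= y -> J y) -> UC J f ->
  exists K : R, forall x y, J x -> J y -> `|x - y| <= L -> `|f x - f y| <= K.
Proof.
move=> Jup /UCP /(_ _ ltr01)[d d0 H].
have chain n x y : J x -> x <= y -> y - x <= n%:R * (d / 2) ->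
    `|f x - f y| <= n%:R.
  elim: n x => [|n IH] x Jx xy.
    rewrite mul0r subr_le0 => yx.
    have -> : x = y by apply/eqP; rewrite eq_le xy.
    by rewrite subrr normr0.
  rewrite -natr1 => xyn; case: (leP y (x + d / 2)) => yx.
    have : `|f x - f y| < 1.
      apply: H => //; first exact: Jup xy.
      by rewrite ler0_norm ?subr_le0//; lra.
    by move=> /ltW/le_trans; apply; rewrite lerDr.
  have xz : x <= x + d / 2 by lra.
  rewrite -(subrKA (f (x + d / 2))) (le_trans (ler_normD _ _))// addrC lerD//.
    by apply: IH; [exact: Jup xz|exact: ltW|lra].
  apply/ltW/H => //; first exact: Jup xz.
  by rewrite ler0_norm ?subr_le0//; lra.
have [n Ln] : exists n : nat, L <= n%:R * (d / 2).
  exists (Num.truncn (L / (d / 2))).+1.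
  by rewrite -ler_pdivrMr ?divr_gt0// ltW// truncnS_gt.
exists n%:R => x y Jx Jy xyL; wlog xy : x y Jx Jy xyL / x <= y => [W|].
  have [xy|/ltW yx] := leP x y; first exact: W.
  by rewrite distrC; apply: W => //; rewrite distrC.
apply: chain => //; rewrite (le_trans _ Ln)// (le_trans _ xyL)//.
by rewrite distrC ler_norm.
Qed.

Lemma UC_zeros_bounded {R : realType} {X : normedModType R} (J : set R)
    (f : R -> X) (L : R) :
  (forall x y, J x -> x <= y -> J y) -> UC J f ->
  (forall t, J t -> exists z, [/\ J z, `|t - z| <= L & f z = 0]) ->
  exists K : R, forall t, J t -> `|f t| <= K.
Proof.
move=> Jup /(UC_dist_bounded _ _ L Jup)[K HK] zeros; exists K => t Jt.
have [z [Jz tz fz]] := zeros t Jt.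
by have := HK _ _ Jt Jz tz; rewrite fz subr0.
Qed.

Lemma UC_scale {R : realType} {X : normedModType R} (J : set R)
    (c : R -> R) (f : R -> X) (A B : R) :
  (forall t, J t -> `|c t| <= A) -> (forall t, J t -> `|f t| <= B) ->
  UC J (c : R -> R^o) -> UC J f -> UC J (fun t => c t *: f t).
Proof.
move=> cA fB /UCP cJ /UCP fJ; apply/UCP => e e0.
(* [A] and [B] may be zero, or negative if [J] is empty; these substitutes are safe divisors. *)
pose A' := `|A| + 1; pose B' := `|B| + 1.
have A0 : 0 < A' by rewrite ltr_wpDl.
have B0 : 0 < B' by rewrite ltr_wpDl.
have [d d0 Hc] := cJ (e / 2 / B') ltac:(by rewrite !divr_gt0).
have [d' d'0 Hf] := fJ (e / 2 / A') ltac:(by rewrite !divr_gt0).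
exists (Num.min d d'); first by rewrite lt_min d0.
move=> x y Jx Jy; rewrite lt_min => /andP[xyd xyd'].
have -> : c x *: f x - c y *: f y = (c x - c y) *: f x + c y *: (f x - f y).
  by rewrite scalerBl scalerBr subrKA.
rewrite (le_lt_trans (ler_normD _ _))// [e]splitr ltrD// normrZ.
  have := Hc _ _ Jx Jy xyd; rewrite ltr_pdivlMr//; apply: le_lt_trans.
  rewrite ler_wpM2l// (le_trans (fB _ Jx))// (le_trans (ler_norm _))//.
  by rewrite lerDl.
have := Hf _ _ Jx Jy xyd'; rewrite ltr_pdivlMr// mulrC; apply: le_lt_trans.
rewrite ler_wpM2r// (le_trans (cA _ Jy))// (le_trans (ler_norm _))//.
by rewrite lerDl.
Qed.

Lemma UC_affine {R : realType} (J : set R) (g : R -> R) (a b : R) :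
  (forall x y, `|g x - g y| <= `|x - y|) ->
  UC J ((fun t => g (a + b * t)) : R -> R^o).
Proof.
move=> gL; apply/UCP => e e0; pose C := `|b| + 1.
have C0 : 0 < C by rewrite ltr_wpDl.
exists (e / C); first by rewrite divr_gt0.
move=> x y _ _; rewrite ltr_pdivlMr//; apply: le_lt_trans.
rewrite (le_trans (gL _ _))// opprD addrACA subrr add0r -mulrBr normrM mulrC.
by rewrite ler_wpM2l// lerDl.
Qed.

Lemma bounded_onP {R : realType} {X : normedModType R} (J : set R)
    (f : R -> X) :
  [bounded f t | t in J] <-> exists B : R, forall t, J t -> `|f t| <= B.
Proof.
split=> [[M [_ HM]]|[B HB]].
  by exists (M + 1) => t Jt; apply: (HM (M + 1)) => //; rewrite ltrDl.
by exists B; split=> [|M /ltW BM t Jt]; [exact: num_real|exact/(le_trans _ BM)/HB].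
Qed.

Lemma BUC_scale {R : realType} {X : normedModType R} (J : set R)
    (c : R -> R) (f : R -> X) :
  BUC J (c : R -> R^o) -> BUC J f -> BUC J (fun t => c t *: f t).
Proof.
move=> [cu /bounded_onP[A cA]] [fu /bounded_onP[B fB]]; split.
  exact: (UC_scale _ _ _ A B).
apply/bounded_onP; exists (A * B) => t Jt.
by rewrite normrZ ler_pM//; [exact: cA|exact: fB].
Qed.

Lemma BUCB {R : realType} {X : normedModType R} (J : set R) (f g : R -> X) :
  BUC J f -> BUC J g -> BUC J (fun t => f t - g t).
Proof.
move=> [fu /bounded_onP[A fA]] [gu /bounded_onP[B gB]].
split; first exact: UCB.
apply/bounded_onP; exists (A + B) => t Jt.
by rewrite (le_trans (ler_normB _ _))// lerD//; [exact: fA|exact: gB].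
Qed.

Lemma BUC_cst {R : realType} {X : normedModType R} (J : set R) (k : X) :
  BUC J (fun=> k).
Proof.
split; last by apply/bounded_onP; exists `|k|.
by apply/UCP => e e0; exists 1 => // *; rewrite subrr normr0.
Qed.

Lemma BUC_cos_affine {R : realType} (J : set R) (a b : R) :
  BUC J ((fun t => cos (a + b * t)) : R -> R^o).
Proof.
split; first exact/UC_affine/dist_cos_le.
by apply/bounded_onP; exists 1 => t _; exact: cos_max.
Qed.

Lemma UC_shift {R : realType} {Y : pseudoMetricNormedZmodType R} (J : set R)
    (f : R -> Y) (a : R) :
  (forall x y, J x -> x <= y -> J y) -> 0 <= a -> UC J f ->
  UC J (fun t => f (a + t)).
Proof.
move=> Jup a0 /UCP fJ; apply/UCP => e /fJ[d d0 H]; exists d => // x y Jx Jy xy.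
apply: H; first by apply: Jup Jx _; rewrite lerDr.
  by apply: Jup Jy _; rewrite lerDr.
by rewrite opprD addrACA subrr add0r.
Qed.

Lemma BUC_shift {R : realType} {X : normedModType R} (J : set R)
    (f : R -> X) (a : R) :
  (forall x y, J x -> x <= y -> J y) -> 0 <= a -> BUC J f ->
  BUC J (fun t => f (a + t)).
Proof.
move=> Jup a0 [fu /bounded_onP[B fB]]; split; first exact: UC_shift.
apply/bounded_onP; exists B => t Jt; apply: fB; apply: Jup Jt _.
by rewrite lerDr.
Qed.

(** * Bounded uniform continuity from the real and imaginary parts of [T phi] *)

Lemma BUC_sin_scale {R : realType} {X : normedModType R} (J : set R)
    (f : R -> X) (a b : R) :
  (forall x y, J x -> x <= y -> J y) -> 0 < b ->
  UC J (fun t => sin (a + b * t) *: f t) ->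
  BUC J (fun t => sin (a + b * t) *: f t).
Proof.
move=> Jup b0 fu; split=> //; apply/bounded_onP.
apply: (UC_zeros_bounded _ _ (pi / b) Jup fu) => t Jt.
(* A zero [y] of the sine within [pi] above the phase pulls back to [(y - a) / b], between [t] and
   [t + pi / b]. *)
have [y /andP[ty yt] y0] := sin_zero_near (a + b * t).
have tz : t <= (y - a) / b by rewrite ler_pdivlMr//; lra.
exists ((y - a) / b); split; first exact: Jup tz.
  rewrite ler0_norm ?subr_le0// opprB lerBlDr ler_pdivrMr//.
  by rewrite mulrDl divfK ?gt_eqF//; lra.
by rewrite mulrC divfK ?gt_eqF// addrC subrK y0 scale0r.
Qed.

(** By the addition formula [sin 2] is twice [sin 1 * cos 1]. It serves as a divisor in the next
    proof. *)
Lemma sin2_gt0 {R : realType} : 0 < sin 2 :> R.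
Proof.
rewrite -[2]/(1 + 1) sinD [cos 1 * _]mulrC -mulr2n mulrn_wgt0// mulr_gt0//.
  by apply: sin_gt0_pi; rewrite ltr01/= (lt_le_trans _ (pi_ge2 R))// ltr1n.
exact: cos1_gt0.
Qed.

(* With [b = 3 + 2t], the phases of [sin b] and [sin (2 b - 2)] are never
   simultaneously multiples of [pi]:
   [sin 2 = 2 sin b cos b cos (2 b - 2) - cos (2 b) sin (2 b - 2)]. *)
Lemma BUC_of_trig {R : realType} {X : normedModType R} (J : set R)
    (phi : R -> X) :
  (forall x y, J x -> x <= y -> J y) ->
  (forall s, 0 < s ->
    UC J (fun t => cos (s ^+ 2 + 2 * s * t) *: phi (s + t) - phi t)) ->
  (forall s, 0 < s ->
    UC J (fun t => sin (s ^+ 2 + 2 * s * t) *: phi (s + t))) ->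
  BUC J phi.
Proof.
move=> Jup Hc Hs.
have phi2 : BUC J (fun t => phi (2 + t)).
  have A : BUC J (fun t => sin (3 + 2 * t) *: phi (2 + t)).
    (* Translating the case [s = 1] by 1 turns the phase [1 + 2 t] into [3 + 2 t] and aligns the
       argument of [phi] with the case [s = 2]. *)
    have /(BUC_shift _ _ 1 Jup ler01) :
        BUC J (fun t => sin (1 ^+ 2 + 2 * 1 * t) *: phi (1 + t)).
      by apply: BUC_sin_scale => //; exact: Hs.
    congr BUC; apply/funext => t; rewrite addrA; congr (sin _ *: _).
    by ring.
  have B : BUC J (fun t => sin (4 + 4 * t) *: phi (2 + t)).
    have := Hs 2 (ltr0Sn R 1).
    have -> : 2 ^+ 2 = 4 :> R by ring.
    have -> : 2 * 2 = 4 :> R by ring.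
    exact: BUC_sin_scale.
  (* [G] is the first term of the identity for [sin 2], times [phi (2 + t)]; the phases are
     [b = 3 + 2 t], [2 b - 2 = 4 + 4 t] and [2 b = 6 + 4 t]. *)
  have G := BUC_scale _ _ _ (BUC_cst J (2 : R^o)) (BUC_scale _ _ _
    (@BUC_cos_affine R J 3 2) (BUC_scale _ _ _ (BUC_cos_affine J 4 4) A)).
  have := BUC_scale _ _ _ (BUC_cst J ((sin 2)^-1 : R^o))
    (BUCB _ _ _ G (BUC_scale _ _ _ (@BUC_cos_affine R J 6 4) B)).
  congr BUC; apply/funext => t; rewrite !scalerA -scalerBl scalerA.
  rewrite -[RHS]scale1r; congr (_ *: _).
  apply: (mulfI (x := sin 2)); first by rewrite gt_eqF ?sin2_gt0.
  rewrite mulr1 mulVKf ?gt_eqF ?sin2_gt0//.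
  set b := 3 + 2 * t.
  have -> : 6 + 4 * t = b + b by rewrite /b; ring.
  have -> : 4 + 4 * t = b + b - 2 by rewrite /b; ring.
  have -> : sin 2 = sin (b + b - (b + b - 2)) :> R by congr sin; ring.
  by rewrite [RHS]sinB (sinD b b); ring.
have phiu : UC J phi.
  have [] := BUC_scale _ _ _ (@BUC_cos_affine R J (2 ^+ 2) (2 * 2)) phi2.
  move=> /UCB/(_ (Hc 2 (ltr0Sn R 1))) + _.
  by congr UC; apply/funext => t; rewrite subKr.
(* On the half-line [phi (2 + t)] misses the values of [phi] on [[0, 2[]; they are reached because
   [phi] changes boundedly over distance 2. *)
split => //; apply/bounded_onP.
have [K HK] := UC_dist_bounded _ _ 2 Jup phiu.
have [_ /bounded_onP[B HB]] := phi2.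
exists (K + B) => t Jt; rewrite -(subrK (phi (2 + t)) (phi t)).
rewrite (le_trans (ler_normD _ _))// lerD ?HB// HK//.
  by apply: Jup Jt _; rewrite lerDr.
by rewrite opprD addrCA subrr addr0 normrN ger0_norm.
Qed.

(** * Continuity within [J] and decay at infinity *)

Lemma within_continuous_distP {R : realType} {Y : pseudoMetricNormedZmodType R}
    (J : set R) (f : R -> Y) :
  {within J, continuous f} <-> forall x e, J x -> 0 < e -> exists2 d : R, 0 < d &
    forall y, J y -> `|x - y| < d -> `|f x - f y| < e.
Proof.
split => [/subspace_continuousP fJ x e Jx e0|H].
  have /cvgrPdist_lt/(_ e e0) := fJ x Jx.
  move=> /nbhs_ballP[d /= d0 H]; exists d => // y Jy xy.
  by apply: H => //; rewrite -ball_normE.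
apply/subspace_continuousP => x Jx; apply/cvgrPdist_lt => e e0.
have [d d0 Hd] := H x e Jx e0.
apply/nbhs_ballP; exists d => //= y; rewrite -ball_normE/= => xy Jy.
exact: Hd.
Qed.

Lemma UC_continuous {R : realType} {Y : pseudoMetricNormedZmodType R}
    (J : set R) (f : R -> Y) : UC J f -> {within J, continuous f}.
Proof.
move=> /UCP fu; apply/within_continuous_distP => x e Jx /fu[d d0 H].
by exists d => // y Jy; exact: H.
Qed.

Lemma within_continuousZ {R : realType} {X : normedModType R} (J : set R)
    (c : R -> R) (f : R -> X) :
  continuous c -> {within J, continuous f} ->
  {within J, continuous (fun t => c t *: f t)}.
Proof.
move=> cc /subspace_continuousP fJ; apply/subspace_continuousP => x Jx.
apply: cvgZ (fJ x Jx); apply: cvg_trans (cc x).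
exact/cvg_app/cvg_within.
Qed.

(* The zeros accumulate at infinity, so the modulus of continuity bounds [g]. *)
Lemma UC_zeros_vanish {R : realType} {X : normedModType R} (J : set R)
    (g : R -> X) (L : R) :
  (forall t k, J t -> 0 <= k -> J (k * t)) -> UC J g ->
  (forall x, exists2 y, x <= y <= x + L & forall t, t ^+ 2 = y -> g t = 0) ->
  forall e : R, 0 < e -> exists M : R, forall t, J t -> M < `|t| -> `|g t| < e.
Proof.
move=> Jcone /UCP gu zeros e /gu[d d0 H].
(* The zero [z] chosen below satisfies [|t - z| * |t| <= |L|], so [|t - z| < d] beyond this
   threshold. *)
exists (`|L| / d) => t Jt Lt.
have t0 : 0 < `|t| by apply: le_lt_trans Lt; rewrite divr_ge0// ltW.
have [y /andP[ty yt] y0] := zeros (t ^+ 2).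
have ys : 0 <= y by rewrite (le_trans _ ty)// sqr_ge0.
have tsq : `|t| ^+ 2 = t ^+ 2 by rewrite real_normK// num_real.
have sy : Num.sqrt y ^+ 2 = y by rewrite sqr_sqrtr.
have sle : `|t| <= Num.sqrt y by rewrite -sqrtr_sqr ler_sqrt.
(* The square root of [y] with the sign of [t], written as a nonnegative multiple of [t] so that it
   stays in [J]. *)
pose z := Num.sqrt y / `|t| * t.
have gz : g z = 0.
  by apply: y0; rewrite !exprMn exprVn sy tsq divfK// sqrf_eq0 -normr_eq0 gt_eqF.
rewrite -[g t]subr0 -gz; apply: H => //.
  by apply: Jcone => //; rewrite divr_ge0// sqrtr_ge0.
have -> : t - z = (1 - Num.sqrt y / `|t|) * t by rewrite /z; ring.
rewrite normrM ler0_norm ?subr_le0 ?ler_pdivlMr ?mul1r//.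
rewrite opprB mulrBl divfK ?gt_eqF// mul1r.
rewrite -(ltr_pM2r t0); apply: le_lt_trans (_ : `|L| < _); last first.
  by rewrite -ltr_pdivrMl// mulrC.
(* The right-hand side is [y - t ^+ 2], which is at most [L]. *)
have : (Num.sqrt y - `|t|) * `|t| <= (Num.sqrt y - `|t|) * (Num.sqrt y + `|t|).
  by apply: ler_wpM2l; [rewrite subr_ge0|rewrite lerDr sqrtr_ge0].
move=> /le_trans; apply; rewrite (le_trans _ (ler_norm L))//.
by rewrite -subr_sqr sy tsq lerBlDl.
Qed.

Lemma C0_of_trig {R : realType} {X : normedModType R} (J : set R) (d : R -> X) :
  (forall t k, J t -> 0 <= k -> J (k * t)) ->
  UC J (fun t => cos (t ^+ 2) *: d t) -> UC J (fun t => sin (t ^+ 2) *: d t) ->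
  C0 J d.
Proof.
move=> Jcone cu su.
(* As [cos^2 + sin^2 = 1], both continuity and decay pass from the two products to [d]. *)
have dE t : d t = cos (t ^+ 2) *: (cos (t ^+ 2) *: d t) +
                  sin (t ^+ 2) *: (sin (t ^+ 2) *: d t).
  by rewrite !scalerA -scalerDl -!expr2 cos2Dsin2 scale1r.
split.
  have sqc : continuous (fun t : R => t ^+ 2) by exact: exprn_continuous.
  have cosc : continuous (fun t : R => cos (t ^+ 2)).
    by move=> t; apply: continuous_comp; [exact: sqc|exact: continuous_cos].
  have sinc : continuous (fun t : R => sin (t ^+ 2)).
    by move=> t; apply: continuous_comp; [exact: sqc|exact: continuous_sin].
  have /subspace_continuousP c1 := within_continuousZ _ _ _ cosc (UC_continuous _ _ cu).
  have /subspace_continuousP c2 := within_continuousZ _ _ _ sinc (UC_continuous _ _ su).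
  rewrite (funext dE); apply/subspace_continuousP => x Jx.
  exact: cvgD (c1 x Jx) (c2 x Jx).
move=> e e0; have e2 : 0 < e / 2 by rewrite divr_gt0.
have [|M1 HM1] := UC_zeros_vanish _ _ pi Jcone cu _ _ e2.
  move=> x; have [y xy y0] := cos_zero_near x; exists y => // t ->.
  by rewrite y0 scale0r.
have [|M2 HM2] := UC_zeros_vanish _ _ pi Jcone su _ _ e2.
  move=> x; have [y xy y0] := sin_zero_near x; exists y => // t ->.
  by rewrite y0 scale0r.
exists (Num.max M1 M2) => t Jt; rewrite gt_max => /andP[Mt1 Mt2].
rewrite dE (le_lt_trans (ler_normD _ _))// [e]splitr ltrD// normrZ.
  by rewrite (le_lt_trans _ (HM1 _ Jt Mt1))// ler_piMl// cos_max.
by rewrite (le_lt_trans _ (HM2 _ Jt Mt2))// ler_piMl// sin_max.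
Qed.

(** * Continuity of functions whose differences are in [C0] *)

(* [f t - (f n - (f (t + n) - f t)) = f (t + n) - f n] tends to [0]: so [f] is a
   pointwise limit of continuous functions, and Baire's theorem yields a point
   near which [f] is uniformly close to one of them. *)
Lemma Delta_C0_small_oscillation {R : realType} {X : normedModType R} (J : set R)
    (f : R -> X) :
  (forall t, 0 <= t -> J t) -> (forall h, 0 < h -> C0 J (Delta h f)) ->
  forall e : R, 0 < e -> exists t0 : R, exists2 d : R, 0 < t0 /\ 0 < d &
    forall t, `|t0 - t| < d -> 0 < t /\ `|f t0 - f t| < e.
Proof.
(* Five errors add up: [e + e] between [f] and [p N] at each of two points, and [e] for the
   variation of [p N]. *)
move=> J0 fC0 e0 e00; pose e := e0 / 5.
have e_gt0 : 0 < e by rewrite divr_gt0.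
(* The successor keeps the step of the difference positive, as the hypothesis on [Delta]
   requires. *)
pose p n t := f n.+1%:R - Delta n.+1%:R f t.
have pf t r : 0 < t -> 0 < r -> \forall n \near \oo, `|p n t - f t| < r.
  move=> t0 r0; have [_ /(_ _ r0)[M HM]] := fC0 t t0.
  near=> n.
  have -> : p n t - f t = - Delta t f n.+1%:R.
    by rewrite /p /Delta !opprB addrCA [f t + _]addrC addrK [t + _]addrC.
  rewrite normrN; apply: HM; first exact: J0.
  rewrite ger0_norm// (lt_trans (truncnS_gt M))// ltr_nat ltnS.
  by near: n; exact: nbhs_infty_gt.
have pc n t : 0 < t -> {for t, continuous (p n)}.
  move=> t0; apply: cvgB; first exact: cvg_cst.
  have [/subspace_continuousP c _] := fC0 n.+1%:R (ltr0Sn _ _).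
  have := c t (J0 _ (ltW t0)); rewrite within_interior//.
  by apply: filterS (lt_nbhsr t0) => x /ltW /J0.
(* The approximants are continuous on the open half-line; [expR] transports them to the whole line,
   where Baire's theorem is applied. [A N] collects the points where they are [e]-close to one
   another from rank [N] on. *)
pose A N := [set x | forall n m, (N <= n)%N -> (N <= m)%N ->
                 `|p n (expR x) - p m (expR x)| <= e].
have pe n : continuous (fun x => p n (expR x)).
  by move=> x; apply: continuous_comp; [exact: continuous_expR|exact/pc/expR_gt0].
have Aclosed N : closed (A N).
  have -> : A N = \bigcap_(nm in
      [set nm : nat * nat | (N <= nm.1)%N /\ (N <= nm.2)%N])
      [set x | `|p nm.1 (expR x) - p nm.2 (expR x)| <= e].
    apply/seteqP; split => [x Ax [n m] [/= Nn Nm]|x Ax n m Nn Nm]; first exact: Ax.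
    exact: (Ax (n, m)).
  apply: closed_bigI => -[n m] _ /=.
  apply: (preimage_closed (f := fun x => `|p n (expR x) - p m (expR x)|)
                      (D := [set y | y <= e])).
    by move=> x _; apply: cvg_norm; apply: cvgB; exact: pe.
  exact: closed_le.
have Acover x : exists N, A N x.
  have e2 : 0 < e / 2 by rewrite divr_gt0.
  have [N _ HN] := pf _ _ (expR_gt0 x) e2.
  exists N => n m Nn Nm; rewrite -(subrKA (f (expR x))) ltW//.
  rewrite (le_lt_trans (ler_normD _ _))// [e]splitr ltrD//; first exact: HN.
  by rewrite distrC; exact: HN.
(* Otherwise the complements are open and dense, and a point common to all of them contradicts
   [Acover]. *)
have [N ndense] : exists N, ~ dense (~` A N).
  apply/existsNP => dA.
  have := @Baire R (R^o) (fun N => ~` A N)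
    (fun N => conj (closed_openC (Aclosed N)) (dA N)).
  move=> /(_ setT (ex_intro _ 0 I) openT)[x [_ Hx]].
  by have [N AN] := Acover x; exact: (Hx N).
have [U [[x0 [Uo Ux0]] UA]] := denseNE ndense.
have UE x : U x -> `|p N (expR x) - f (expR x)| < e + e.
  move=> Ux; have AN : A N x.
    by apply: contrapT => nA; have : (U `&` ~` A N) x by []; rewrite UA.
  have [M _ HM] := pf _ _ (expR_gt0 x) e_gt0.
  (* Any rank beyond both [N] and [M] links [p N] to [f]. *)
  rewrite -(subrKA (p (maxn N M) (expR x))).
  rewrite (le_lt_trans (ler_normD _ _))// ler_ltD//.
    by apply: AN => //; exact: leq_maxl.
  by apply: HM => /=; exact: leq_maxr.
have t00 := expR_gt0 x0; exists (expR x0).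
have : \forall t \near expR x0,
    [/\ 0 < t, U (ln t) & `|p N (expR x0) - p N t| < e].
  near=> t; split.
  - by near: t; exact: lt_nbhsr.
  - near: t; apply: (continuous_ln t00).
    by rewrite expRK; exact: open_nbhs_nbhs.
  - by near: t; have /cvgrPdist_lt/(_ _ e_gt0) := pc N _ t00.
move=> /nbhs_ballP[d /= d0 Hd]; exists d => // t.
rewrite -ball_normE/= in Hd.
move=> /Hd[t_gt0 Ulnt pp]; split => //.
have := UE _ Ulnt; rewrite lnK// => pft.
have := UE _ Ux0; rewrite distrC => pft0.
rewrite -(subrKA (p N (expR x0))) -(subrKA (p N t) (p N (expR x0))).
rewrite (le_lt_trans (ler_normD _ _))//.
rewrite (le_lt_trans (lerD (lexx _) (ler_normD _ _)))//.
have -> : e0 = (e + e) + (e + (e + e)) by rewrite /e; field.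
by rewrite !ltrD.
Unshelve. all: end_near. Qed.

(** Small oscillation near a single [t0], depending on [e], is carried to [a] by translation: [f]
    and its translate by [a - t0] differ by a continuous difference of [f], which costs another
    [e / 2]. *)
Lemma Delta_C0_continuous {R : realType} {X : normedModType R} (J : set R)
    (f : R -> X) :
  (forall x y, J x -> x <= y -> J y) -> (forall t, 0 <= t -> J t) ->
  (forall h, 0 < h -> C0 J (Delta h f)) -> {within J, continuous f}.
Proof.
move=> Jup J0 fC0; apply/within_continuous_distP => a e Ja e0.
have e2 : 0 < e / 2 by rewrite divr_gt0.
have [t0 [d [t00 d0] Hd]] := Delta_C0_small_oscillation _ _ J0 fC0 _ e2.
have [ta|ta|->] := ltgtP a t0; last first.
- by exists d => // t _ /Hd[_] /lt_trans; apply; lra.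
- have s0 : 0 < a - t0 by rewrite subr_gt0.
  have [/within_continuous_distP/(_ t0 _ (J0 _ (ltW t00)) e2)[d' d'0 Hd'] _] :=
    fC0 _ s0.
  exists (Num.min d d'); first by rewrite lt_min d0.
  move=> t Jt; rewrite lt_min => /andP[td td'].
  have tE : t0 - (t - (a - t0)) = a - t by ring.
  (* The positivity supplied with the small oscillation puts the translated point in [J]. *)
  have [s_gt0 fs] : 0 < t - (a - t0) /\ `|f t0 - f (t - (a - t0))| < e / 2.
    by apply: Hd; rewrite tE.
  have := Hd' _ (J0 _ (ltW s_gt0)); rewrite tE => /(_ td').
  rewrite /Delta subrK [t0 + _]addrC subrK => fd.
  have -> : f a - f t = (f a - f t0 - (f t - f (t - (a - t0)))) +
                        (f t0 - f (t - (a - t0))).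
    by rewrite opprB addrACA subrK addrAC subrr add0r.
  by rewrite (le_lt_trans (ler_normD _ _))// [e]splitr ltrD.
- have s0 : 0 < t0 - a by rewrite subr_gt0.
  have [/within_continuous_distP/(_ a _ Ja e2)[d' d'0 Hd'] _] := fC0 _ s0.
  exists (Num.min d d'); first by rewrite lt_min d0.
  move=> t Jt; rewrite lt_min => /andP[td td'].
  have [_ fs] : 0 < t + (t0 - a) /\ `|f t0 - f (t + (t0 - a))| < e / 2.
    by apply: Hd; rewrite (_ : _ - _ = a - t)//; ring.
  have := Hd' _ Jt td'; rewrite /Delta [a + _]addrC subrK => fd.
  have -> : f a - f t = (f t0 - f (t + (t0 - a))) -
                        (f t0 - f a - (f (t + (t0 - a)) - f t)).
    by rewrite !opprB addrA subrKA addrC subrKA.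
  by rewrite (le_lt_trans (ler_normB _ _))// [e]splitr ltrD.
Qed.

(** * Local integrability: approximation by rounding to finite grids *)

Section grid.
Context {R : realType}.

Definition clamp (n : nat) (t : R) : R := Num.max (- n%:R) (Num.min n%:R t).

(** Rounding down to the grid of mesh [1 / n] in [[-n, n]]. Adding [n] first makes the truncated
    number nonnegative; for [n = 0] the convention [0^-1 = 0] gives the value 0. *)
Definition grid_floor (n : nat) (t : R) : R :=
  (Num.truncn (n%:R * (clamp n t + n%:R)))%:R / n%:R - n%:R.

Lemma clamp_ge n t : - n%:R <= clamp n t.
Proof. by rewrite le_max lexx. Qed.

Lemma clamp_le n t : clamp n t <= n%:R.
Proof. by rewrite ge_max ge_min lexx andbT (le_trans (y := 0)) ?oppr_le0. Qed.

Lemma le_clamp n : {homo clamp n : s t / s <= t}.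
Proof.
move=> s t st; rewrite ge_max !le_max lexx/=; apply/orP; right.
by rewrite le_min !ge_min lexx st orbT.
Qed.

Lemma clamp_id n t : `|t| <= n%:R -> clamp n t = t.
Proof.
by rewrite ler_norml /clamp => /andP[nt tn]; rewrite (min_idPr tn) (max_idPr nt).
Qed.

Lemma le_grid_floor n : {homo grid_floor n : s t / s <= t}.
Proof.
move=> s t /(le_clamp n) st; rewrite lerD2r ler_wpM2r ?invr_ge0//.
by rewrite ler_nat le_truncn// ler_wpM2l// lerD2r.
Qed.

(** After clamping, [t + n] lies in [[0, 2 n]]; the largest index [n * (n + n)] is attained, whence
    the successor. *)
Lemma grid_floor_range n t :
  exists2 k : nat, (k < (n * (n + n)).+1)%N & grid_floor n t = k%:R / n%:R - n%:R.
Proof.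
exists (Num.truncn (n%:R * (clamp n t + n%:R))) => //.
rewrite ltnS -(ler_nat R) (@le_trans _ _ (n%:R * (clamp n t + n%:R)))//.
  by rewrite truncn_le mulr_ge0// -lerBlDr sub0r clamp_ge.
by rewrite natrM natrD ler_wpM2l// lerD2r clamp_le.
Qed.

(** For [n > 0], 0 is the grid point of index [n * n], so rounding down cannot cross it. *)
Lemma grid_floor_ge0 n t : 0 <= t -> 0 <= grid_floor n t.
Proof.
move=> t0; have c0 : 0 <= clamp n t by rewrite le_max le_min t0 ler0n orbT.
have [->|n0] := eqVneq n 0%N; first by rewrite /grid_floor subr0 mulr_ge0// invr_ge0.
rewrite subr_ge0 ler_pdivlMr ?ltr0n ?lt0n// -natrM ler_nat.
by rewrite truncn_ge_nat ?mulr_ge0 ?addr_ge0// natrM ler_wpM2l// lerDr.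
Qed.

Lemma grid_floor_dist n t : (0 < n)%N -> `|t| <= n%:R ->
  `|t - grid_floor n t| <= n%:R^-1.
Proof.
move=> n0 tn; have N0 : 0 < n%:R :> R by rewrite ltr0n.
rewrite /grid_floor clamp_id//.
have /truncn_itv/andP[] : 0 <= n%:R * (t + n%:R).
  by rewrite mulr_ge0// -lerBlDr sub0r; move: tn; rewrite ler_norml => /andP[].
set k := Num.truncn _; rewrite -natr1 => kt tk.
have -> : t - (k%:R / n%:R - n%:R) = (n%:R * (t + n%:R) - k%:R) / n%:R.
  by field; rewrite gt_eqF.
rewrite normrM [X in _ * X]ger0_norm ?invr_ge0// ler_piMl ?invr_ge0//.
by rewrite ger0_norm ?subr_ge0// lerBlDl ltW.
Qed.

Lemma cvg_grid_floor t : grid_floor n t @[n --> \oo] --> t.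
Proof.
apply/cvgrPdist_le => e e0; near=> n.
have n0 : (0 < n)%N by near: n; exact: nbhs_infty_gt.
rewrite (le_trans (grid_floor_dist _ _ n0 _))//.
  rewrite (le_trans (ltW (truncnS_gt _)))// ler_nat.
  by near: n; exact: nbhs_infty_gt.
rewrite -[e]invrK lef_pV2 ?posrE ?invr_gt0 ?ltr0n//.
rewrite (le_trans (ltW (truncnS_gt _)))// ler_nat.
by near: n; exact: nbhs_infty_gt.
Unshelve. all: end_near. Qed.

(** [f] may be arbitrary: each fibre is a countable union of level sets of a monotone map. *)
Lemma simple_function_grid_floor {Y : normedModType R} (f : R -> Y) n :
  simple_function (f \o grid_floor n).
Proof.
pose v k : R := k%:R / n%:R - n%:R.
split.
  apply: (@sub_finite_set _ _ ((f \o v) @` `I_(n * (n + n)).+1)).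
    move=> _ [t _ <-] /=; have [k kn ->] := grid_floor_range n t.
    by exists k.
  exact/finite_image/finite_II.
move=> y.
have -> : (f \o grid_floor n) @^-1` [set y] =
    \bigcup_(k in [set k | f (v k) = y]) (grid_floor n @^-1` [set v k]).
  apply/seteqP; split=> [t /= fy|t [k /= fk ->]]; last exact: fk.
  by have [k _ tk] := grid_floor_range n t; exists k => //=; rewrite /v -tk.
apply: bigcup_measurable => k _.
have := measurable_realfun.nondecreasing_measurable measurableT (le_grid_floor n).
by move=> /(_ measurableT [set v k]); rewrite setTI; apply; exact: measurable_set1.
Qed.

End grid.

(** Rounding stays in [J] and tends to the identity, so continuity gives pointwise convergence of
    the simple functions; on a compact set the continuous norm is integrable. *)
Lemma within_continuous_L1loc {R : realType} {X : normedModType R} (J : set R)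
    (f : R -> X) :
  (forall n t, J t -> J (grid_floor n t)) ->
  {within J, continuous f} -> L1loc J f.
Proof.
move=> Jgrid fc; split.
  exists (fun n => f \o grid_floor n); split.
    by move=> n; exact: simple_function_grid_floor.
  apply: aeW => t Jt; apply/cvgrPdist_lt => e e0.
  move/within_continuous_distP : fc => /(_ t e Jt e0)[d d0 H].
  have /cvgrPdist_lt/(_ _ d0) := cvg_grid_floor t.
  by apply: filterS => n /H; apply; exact: Jgrid.
move=> K KJ Kc.
have /integrableP[_] : lebesgue_measure.-integrable K (EFin \o (fun t => `|f t|)).
  apply: continuous_compact_integrable => //.
  apply: (continuous_subspaceW KJ); apply/subspace_continuousP => t Jt.
  by apply: cvg_norm; move/subspace_continuousP : fc; apply.
by congr (_ < _)%E; apply: eq_integral => t _; rewrite /= normr_id.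
Qed.

(** * Reduction of the three statements to real and imaginary parts of [T] *)

Lemma DeltaC0_of_trig {R : realType} {X : normedModType R} (J : set R)
    (f : R -> X) :
  J = `[0, +oo[%classic \/ J = [set: R] ->
  (forall s, 0 < s -> UC J (fun t => cos (t ^+ 2) *: Delta s f t)) ->
  (forall s, 0 < s -> UC J (fun t => sin (t ^+ 2) *: Delta s f t)) ->
  DeltaC0 J f.
Proof.
move=> hJ cu su.
have J0 t : 0 <= t -> J t by case: hJ => -> //=; rewrite in_itv/= andbT.
have Jcone t k : J t -> 0 <= k -> J (k * t).
  by case: hJ => -> //=; rewrite !in_itv/= !andbT => t0 k0; rewrite mulr_ge0.
have Jup x y : J x -> x <= y -> J y.
  by case: hJ => -> //=; rewrite !in_itv/= !andbT; exact: le_trans.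
have Jgrid n t : J t -> J (grid_floor n t).
  by case: hJ => -> //=; rewrite !in_itv/= !andbT; exact: grid_floor_ge0.
have fC0 h : 0 < h -> C0 J (Delta h f).
  by move=> h0; apply: C0_of_trig => //; [exact: cu|exact: su].
split => //; apply: within_continuous_L1loc => //.
exact: Delta_C0_continuous.
Qed.

Lemma Tdiff_to_complexification {R : realType} {X : normedModType R}
    (phi : R -> X) (s t : R) :
  Tdiff (fun t => to_complexification (phi t)) s t =
  (cos (s ^+ 2 + 2 * s * t) *: phi (s + t) - phi t,
   sin (s ^+ 2 + 2 * s * t) *: phi (s + t)).
Proof.
rewrite /Tdiff; congr pair => /=; first by rewrite scaler0 subr0.
by rewrite scaler0 addr0 oppr0 addr0.
Qed.

Lemma BUC_of_Tdiff {R : realType} {X : normedModType R} (J : set R)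
    (phi : R -> X) :
  J = `[0, +oo[%classic \/ J = [set: R] ->
  (forall s : R, 0 < s ->
     UC J (Tdiff (fun t => to_complexification (phi t)) s)) ->
  BUC J phi.
Proof.
move=> hJ Hphi; apply: BUC_of_trig.
- by case: hJ => -> //= x y; rewrite !in_itv/= !andbT; exact: le_trans.
- move=> s /Hphi/UC_fst; congr UC; apply/funext => t.
  by rewrite Tdiff_to_complexification.
- move=> s /Hphi/UC_snd; congr UC; apply/funext => t.
  by rewrite Tdiff_to_complexification.
Qed.

Lemma gaussV {R : realType} (t : R) :
  (gauss t)^-1 = cos (t ^+ 2) +i* - sin (t ^+ 2) :> R[i].
Proof.
apply: (mulfI (expi_neq0 (t ^+ 2))); rewrite divff ?expi_neq0//.
apply/eqP; rewrite eq_complex/=; apply/andP; split; apply/eqP.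
  by rewrite mulrN opprK -!expr2 cos2Dsin2.
by rewrite mulrN mulrC addNr.
Qed.

(** By [TdiffE], [T] is [Delta] conjugated by [gauss], and here [gauss * phi] is [f]. The minus sign
    comes from [1 / gauss]. *)
Lemma Tdiff_div_gauss {R : realType} {X : normedModType R}
    (f : R -> X) (s t : R) :
  Tdiff (fun t => (gauss t)^-1 *: to_complexification (f t)) s t =
  (cos (t ^+ 2) *: Delta s f t, - (sin (t ^+ 2) *: Delta s f t)).
Proof.
rewrite TdiffE (_ : (fun u => _) = fun u => to_complexification (f u)); last first.
  by apply/funext => u; rewrite scalerA divff ?expi_neq0// scale1r.
rewrite gaussV; congr pair => /=; rewrite subrr scaler0.
  by rewrite subr0.
by rewrite addr0 scaleNr.
Qed.

Theorem theorem3p2 (R : realType) (J : set R)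
    (hJ : J = `[0, +oo[%classic \/ J = [set: R])
    (X : completeNormedModType R) :
  [/\ forall phi : R -> R,
        (forall s : R, 0 < s ->
           UC J (Tdiff (fun t => (phi t)%:C : R[i]^o) s)) ->
        BUC J (phi : R -> R^o),
      forall phi : R -> X,
        (forall s : R, 0 < s ->
           UC J (Tdiff (fun t => to_complexification (phi t)) s)) ->
        BUC J phi
    & forall f : R -> X,
        (forall s : R, 0 < s ->
           UC J (Tdiff (fun t => (gauss t)^-1 *: to_complexification (f t)) s)) ->
        DeltaC0 J f].
Proof.
split.
(* The scalar case is the vector case for [R^o], with the hypothesis carried over by [z] to
   [(Re z, Im z)]. *)
- move=> phi Hphi; apply: BUC_of_Tdiff => // s /Hphi.
  move=> /(UC_comp _ _ _ complex_to_complexification_unif_continuous).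
  congr UC; apply/funext => t /=.
  rewrite Tdiff_to_complexification /Tdiff/=; congr pair.
  - by rewrite mulr0 subr0.
  - by rewrite mulr0 add0r oppr0 addr0.
- by move=> phi; exact: BUC_of_Tdiff.
- move=> f Hf; apply: DeltaC0_of_trig => // s /Hf.
    by move=> /UC_fst; congr UC; apply/funext => t; rewrite Tdiff_div_gauss.
  move=> /UC_snd/UCN; congr UC; apply/funext => t.
  by rewrite Tdiff_div_gauss opprK.
Qed.
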